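(* For every integer $m \ge 2$, $\chi_{la}(C_3 \circ \overline{K_m}) = 3m+3$, where $C_3$ is the cycle on $3$ vertices.
   Context: Let $G=(V,E)$ be a finite simple undirected graph with no component isomorphic to $K_2$. A bijection $f : E \to \{1,2,\dots,|E|\}$ is a local antimagic labeling of $G$ if $w(u)\ne w(v)$ for every pair of adjacent vertices $u,v$, where $w(u)=\sum_{e\in E(u)} f(e)$ and $E(u)$ is the set of edges incident to $u$. Such an $f$ induces the proper vertex coloring $v\mapsto w(v)$, which uses $|\{w(v): v\in V\}|$ colors. The local antimagic chromatic number $\chi_{la}(G)$ is the minimum number of colors used over all colorings induced by local antimagic labelings of $G$ (so $\chi_{la}(G)\le k$ means that there is a local antimagic labeling inducing at most $k$ colors). The corona product $G\circ H$ is obtained from one copy of $G$ and $|V(G)|$ copies of $H$ by joining the $i$-th vertex of $G$ to every vertex of the $i$-th copy of $H$, for $1\le i\le |V(G)|$. $\overline{K_m}$ is the null (edgeless) graph on $m$ vertices. *)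

(* Defs.v *)
From mathcomp Require Import all_boot.

Set Implicit Arguments.
Unset Strict Implicit.
Unset Printing Implicit Defensive.

Record sgraph := SGraph {
  vertex :> finType;
  adj : rel vertex;
  adj_sym : symmetric adj;
  adj_irr : irreflexive adj
}.

Definition edges (G : sgraph) : {set {set G}} :=
  [set [set p.1; p.2] | p : G * G & adj p.1 p.2].

Definition incident (G : sgraph) (u : G) : {set {set G}} :=
  [set e in edges G | u \in e].

(* A labeling is a total function on vertex sets, of which only the values on
   [edges G] matter. *)
Definition edge_bijection (G : sgraph) (f : {set G} -> nat) : Prop :=
  {in edges G &, injective f} /\
  [seq f e | e in edges G] =i iota 1 #|edges G|.

Definition weight (G : sgraph) (f : {set G} -> nat) (u : G) : nat :=
  \sum_(e in incident u) f e.

Definition local_antimagic (G : sgraph) (f : {set G} -> nat) : Prop :=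
  edge_bijection f /\ forall u v : G, adj u v -> weight f u <> weight f v.

Definition num_colors (G : sgraph) (f : {set G} -> nat) : nat :=
  size (undup [seq weight f v | v : G]).

(* Stated as a relation, because the minimum is undefined when the graph has no
   local antimagic labeling (for instance, for K_2). *)
Definition chi_la_is (G : sgraph) (k : nat) : Prop :=
  (exists2 f : {set G} -> nat, local_antimagic f & num_colors f = k) /\
  (forall f : {set G} -> nat, local_antimagic f -> k <= num_colors f).

(* This is the n-cycle for n >= 3 only. *)
Definition cycle_adj (n : nat) : rel 'I_n :=
  fun i j => (i != j) && ((i.+1 %% n == j) || (j.+1 %% n == i)).

Lemma cycle_adj_sym n : symmetric (@cycle_adj n).
Proof. by move=> i j; rewrite /cycle_adj eq_sym orbC. Qed.

Lemma cycle_adj_irr n : irreflexive (@cycle_adj n).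
Proof. by move=> i; rewrite /cycle_adj eqxx. Qed.

Definition cycle_graph (n : nat) : sgraph :=
  SGraph (@cycle_adj_sym n) (@cycle_adj_irr n).

Definition null_adj (m : nat) : rel 'I_m := fun _ _ => false.

Lemma null_adj_sym m : symmetric (@null_adj m).
Proof. by []. Qed.

Lemma null_adj_irr m : irreflexive (@null_adj m).
Proof. by []. Qed.

Definition null_graph (m : nat) : sgraph :=
  SGraph (@null_adj_sym m) (@null_adj_irr m).

(* [inl g] is the vertex g of G, and [inr (g, h)] is the vertex h of the copy
   of H attached to g. *)
Definition corona_adj (G H : sgraph) : rel (G + G * H)%type :=
  fun x y => match x, y with
  | inl g, inl g' => adj g g'
  | inl g, inr (g', _) => g == g'
  | inr (g, _), inl g' => g == g'
  | inr (g, h), inr (g', h') => (g == g') && adj h h'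
  end.

Lemma corona_adj_sym (G H : sgraph) : symmetric (@corona_adj G H).
Proof.
by case=> [g|[g h]] [g'|[g' h']] //=; rewrite 1?adj_sym // eq_sym // adj_sym.
Qed.

Lemma corona_adj_irr (G H : sgraph) : irreflexive (@corona_adj G H).
Proof. by case=> [g|[g h]] /=; rewrite adj_irr ?andbF. Qed.

Definition corona (G H : sgraph) : sgraph :=
  SGraph (@corona_adj_sym G H) (@corona_adj_irr G H).

(* Main.v *)
(* The [3 * m] leaf weights are the labels of the pendant edges. The weight of
   a triangle vertex is a sum of [m + 2] distinct positive labels, hence at
   least [(m + 2) * (m + 3) / 2], which for [2 <= m] exceeds the largest label
   [3 * m + 3]. So every local antimagic labeling has an injective weight and
   induces exactly [3 * m + 3] colors; it remains to exhibit one labeling. *)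
Require Import Defs.
From mathcomp Require Import all_boot.
From mathcomp Require Import zify.

Set Implicit Arguments.
Unset Strict Implicit.
Unset Printing Implicit Defensive.

(** Induction on [#|A|], removing an element [x] of largest value: the [n + 1] distinct positive
    values all lie between 1 and [f x], which forces [n < f x]. The factor 2 avoids a division. *)
Lemma leq_sum_inj_pos (T : finType) (A : {set T}) (f : T -> nat) :
  {in A &, injective f} -> {in A, forall x, 0 < f x} ->
  #|A| * #|A|.+1 <= 2 * \sum_(x in A) f x.
Proof.
move: {2}#|A| (erefl #|A|) => n; elim: n A => [|n IHn] A cardA injf posf.
  by rewrite cardA.
have /card_gt0P[x0 Ax0] : 0 < #|A| by rewrite cardA.
case: (arg_maxnP (P := mem A) f Ax0) => x Ax max_x.
have cardAx : #|A :\ x| = n by move: (cardsD1 x A); rewrite [x \in A]Ax cardA; lia.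
have leqfx : n < f x.
  rewrite -cardA cardE -(size_map f) -(size_iota 1 (f x)).
  apply: uniq_leq_size.
    by rewrite map_inj_in_uniq ?enum_uniq // => y z; rewrite !mem_enum; apply: injf.
  move=> _ /mapP[y + ->]; rewrite mem_enum mem_iota => Ay.
  by rewrite posf //= add1n ltnS; apply: max_x.
have subA y : y \in A :\ x -> y \in A by case/setD1P.
have := IHn _ cardAx (fun y z Ay Az => injf y z (subA y Ay) (subA z Az))
  (fun y Ay => posf y (subA y Ay)).
by rewrite (big_setD1 x Ax) cardA cardAx /=; nia.
Qed.

Section Crown.

Variable m : nat.

Let G := corona (cycle_graph 3) (null_graph m).

(* [inl k] stands for the triangle edge from [k] to [k + 1], and [inr p] for the
   edge at the leaf [inr p]. *)
Definition crown_edge (t : 'I_3 + 'I_3 * 'I_m) : {set G} :=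
  match t with
  | inl k => [set inl k; inl (ordS k)]
  | inr p => [set inl p.1; inr p]
  end.

Lemma crown_edge_inj : injective crown_edge.
Proof.
case=> [k|p] [k'|q] /setP eq_e.
(* Both ends of edge [k] lie on edge [k']. If [k] differed from [k'], then [k = k' + 1] and
   [k + 1 = k'], impossible modulo 3. *)
- move: (eq_e (inl k)) (eq_e (inl (ordS k))); rewrite !inE !eqxx orbT /=.
  by case: k k' {eq_e} => [[|[|[|//]]] ?] [[|[|[|//]]] ?] // _ _;
     congr inl; apply: val_inj.
- by move: (eq_e (inr q)); rewrite !inE eqxx orbT.
- by move: (eq_e (inr p)); rewrite !inE eqxx orbT.
- by move: (eq_e (inr p)); rewrite !inE eqxx orbT => /esym /eqP ->.
Qed.

Lemma crown_edges : edges G = crown_edge @: setT.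
Proof.
apply/setP=> e; apply/imsetP/imsetP => [[[u v] /= uv ->]|[t _ ->]].
  move: uv; rewrite inE /=.
  case: u v => [i|[i h]] [j|[j h']] //=.
  - rewrite /cycle_adj => /andP[_ /orP[] /eqP ij].
      by exists (inl i) => //=; congr [set _; inl _]; apply: val_inj.
    by exists (inl j) => //=; rewrite setUC; congr [set _; inl _]; apply: val_inj.
  - by move/eqP=> ->; exists (inr (j, h')).
  - by move/eqP=> <-; exists (inr (i, h)) => //=; rewrite setUC.
  - by rewrite andbF.
case: t => [k|[i h]].
  exists (inl k, inl (ordS k)) => //.
  by rewrite inE /=; case: k => [[|[|[|//]]] ?].
by exists (inl i, inr (i, h)) => //; rewrite inE /= eqxx.
Qed.

Lemma mem_crown_edges t : crown_edge t \in edges G.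
Proof. by rewrite crown_edges imset_f. Qed.

Lemma card_crown_edges : #|edges G| = 3 * m + 3.
Proof.
rewrite crown_edges card_imset; last exact: crown_edge_inj.
by rewrite cardsT card_sum card_prod !card_ord addnC.
Qed.

Lemma crown_incident (u : G) :
  incident u = crown_edge @: [set t | u \in crown_edge t].
Proof.
rewrite /incident crown_edges; apply/setP=> e; rewrite inE.
apply/andP/imsetP => [[/imsetP[t _ ->] ut]|[t + ->]]; rewrite ?inE => *.
  by exists t; rewrite ?inE.
by rewrite imset_f.
Qed.

Lemma sum_incident_leaf (F : {set G} -> nat) (p : 'I_3 * 'I_m) :
  \sum_(e in incident (inr p : G)) F e = F (crown_edge (inr p)).
Proof.
rewrite (_ : incident _ = [set crown_edge (inr p)]) ?big_set1 //.
rewrite crown_incident -imset_set1; apply: (congr1 (fun A : {set _} => crown_edge @: A)).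
by apply/setP=> -[k|q]; rewrite !inE //= eq_sym.
Qed.

(** An arbitrary summand [F] lets this formula give both the weight and, with [F] constantly 1, the
    degree. *)
Lemma sum_incident_cycle (F : {set G} -> nat) (i : 'I_3) :
  \sum_(e in incident (inl i : G)) F e =
  F (crown_edge (inl i)) + F (crown_edge (inl (ord_pred i))) +
  \sum_(j < m) F (crown_edge (inr (i, j))).
Proof.
rewrite crown_incident big_imset /=; last by move=> ? ? _ _; apply: crown_edge_inj.
rewrite big_sumType /=; congr (_ + _).
  rewrite (bigD1 i) ?inE ?eqxx //=; congr (_ + _).
  rewrite (big_pred1 (ord_pred i)) // => k; rewrite !inE.
  by case: i k => [[|[|[|//]]] ?] [[|[|[|//]]] ?].
rewrite (reindex_onto (pair i) snd) /=; last first.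
  by move=> [k j]; rewrite !inE orbF => /eqP[->].
by apply: eq_bigl => j; rewrite !inE !eqxx.
Qed.

Lemma card_incident_cycle (i : 'I_3) : #|incident (inl i : G)| = m + 2.
Proof. by rewrite -sum1_card sum_incident_cycle sum1_card card_ord addnC. Qed.

Section Labeling.

Hypothesis m_ge2 : 2 <= m.
Variable f : {set G} -> nat.
Hypothesis bij_f : edge_bijection f.

Lemma label_bounds t : 0 < f (crown_edge t) <= 3 * m + 3.
Proof.
have /(_ (f (crown_edge t))) := bij_f.2; rewrite mem_iota card_crown_edges.
rewrite image_f ?mem_crown_edges //; lia.
Qed.

Lemma weight_cycle_gt (i : 'I_3) : 3 * m + 3 < weight f (inl i : G).
Proof.
have sub_i : {subset incident (inl i : G) <= edges G}.
  by move=> e; rewrite inE => /andP[].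
have := @leq_sum_inj_pos _ (incident (inl i : G)) f
  (fun e e' ie ie' => bij_f.1 e e' (sub_i e ie) (sub_i e' ie')).
rewrite card_incident_cycle -/(weight f _) => bound.
have {}bound : (m + 2) * (m + 2).+1 <= 2 * weight f (inl i : G).
  apply: bound => e /sub_i; rewrite crown_edges => /imsetP[t _ ->].
  by case/andP: (label_bounds t).
(* If the weight were at most [3 * m + 3], then [(m + 2) * (m + 3) <= 6 * m + 6], that is
   [m ^ 2 <= m], contradicting [2 <= m]. *)
nia.
Qed.

Lemma weight_leaf_lt_cycle (p : 'I_3 * 'I_m) (i : 'I_3) :
  weight f (inr p : G) < weight f (inl i : G).
Proof.
apply: leq_ltn_trans (weight_cycle_gt i).
by rewrite /weight sum_incident_leaf; case/andP: (label_bounds (inr p)).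
Qed.

End Labeling.

Lemma num_colors_crown (f : {set G} -> nat) :
  2 <= m -> local_antimagic f -> num_colors f = 3 * m + 3.
Proof.
move=> m_ge2 [bij_f prop_f]; rewrite /num_colors undup_id.
  by rewrite size_map -cardE card_sum card_prod !card_ord addnC.
rewrite map_inj_uniq ?enum_uniq // => -[i|p] [i'|q] eq_w.
(* Distinct triangle vertices are adjacent, so the labeling itself separates their weights. *)
- case: (eqVneq i i') => [-> //|i_neq]; case: (prop_f (inl i) (inl i')) => //=.
  by case: i i' i_neq {eq_w} => [[|[|[|//]]] ?] [[|[|[|//]]] ?].
- by have := weight_leaf_lt_cycle m_ge2 bij_f q i; rewrite eq_w ltnn.
- by have := weight_leaf_lt_cycle m_ge2 bij_f p i'; rewrite eq_w ltnn.
- move: eq_w; rewrite /weight !sum_incident_leaf => eq_f.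
  by case: (crown_edge_inj (bij_f.1 _ _ (mem_crown_edges _) (mem_crown_edges _) eq_f))
    => ->.
Qed.

(* The triangle edges get 1, 2, 3 and the pendant edges at each vertex a block of
   [m] consecutive labels: the triangle contributes 4, 3, 5 to the weights and
   the blocks contribute [S], [S + m ^ 2], [S + 2 * m ^ 2]. *)
Definition crown_label (t : 'I_3 + 'I_3 * 'I_m) : nat :=
  match t with
  | inl k => k.+1
  | inr p => 4 + p.1 * m + p.2
  end.

(** The code of an edge is unique by [crown_edge_inj], so [pick] recovers it; the default 0 is
    reached only on sets that are not edges. *)
Definition crown_labeling (e : {set G}) : nat :=
  if [pick t | crown_edge t == e] is Some t then crown_label t else 0.

Lemma crown_labelingE t : crown_labeling (crown_edge t) = crown_label t.
Proof.
rewrite /crown_labeling; case: pickP => [t' /eqP/crown_edge_inj -> //|].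
by move/(_ t); rewrite eqxx.
Qed.

Lemma crown_label_inj : injective crown_label.
Proof.
case=> [k|[i j]] [k'|[i' j']] /= eq_l.
- by congr inl; apply: val_inj; case: eq_l.
- by have := ltn_ord k; lia.
- by have := ltn_ord k'; lia.
- have [ltj ltj'] := (ltn_ord j, ltn_ord j').
  (* Since [j] and [j'] are below [m], both [i] and [i'] are the quotient of the same number by
     [m]. *)
  have eqi : i = i' :> nat by nia.
  by congr (inr (_, _)); apply: val_inj => //=; move: eq_l; rewrite eqi; lia.
Qed.

Lemma crown_labeling_bij : edge_bijection crown_labeling.
Proof.
have inj_l : {in edges G &, injective crown_labeling}.
  move=> e e'; rewrite crown_edges => /imsetP[t _ ->] /imsetP[t' _ ->].
  by rewrite !crown_labelingE => /crown_label_inj ->.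
split=> //.
have uniq_l : uniq [seq crown_labeling e | e in edges G].
  by rewrite map_inj_in_uniq ?enum_uniq // => e e'; rewrite !mem_enum; apply: inj_l.
(* A duplicate-free list contained in [iota] and of the same length has the same elements, so only
   the range of the labels remains; the largest is [4 + 2 * m + (m - 1) = 3 * m + 3]. *)
apply: (uniq_min_size uniq_l _ _).2; last by rewrite size_iota size_map -cardE.
move=> _ /mapP[e + ->]; rewrite mem_enum mem_iota card_crown_edges crown_edges.
case/imsetP=> -[k|[i j]] _ ->; rewrite crown_labelingE /=.
  by have := ltn_ord k; lia.
by have := (ltn_ord i, ltn_ord j) => -[]; nia.
Qed.

Lemma weight_crown_labeling (i : 'I_3) :
  weight crown_labeling (inl i : G) =
  i.+1 + (ord_pred i).+1 + (\sum_(j < m) (4 + j) + i * m ^ 2).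
Proof.
rewrite /weight sum_incident_cycle !crown_labelingE; congr (_ + _).
under eq_bigr do rewrite crown_labelingE /= addnAC.
by rewrite big_split /= sum_nat_const card_ord; lia.
Qed.

Lemma crown_labeling_local_antimagic :
  2 <= m -> local_antimagic crown_labeling.
Proof.
move=> m_ge2; have bij_l := crown_labeling_bij; split=> // -[i|p] [i'|q] //= uv.
- have {uv} : i != i' by case/andP: uv.
  (* The triangle contributions 4, 3, 5 differ by at most 2, too little to offset a gap of at least
     [m ^ 2] between blocks. Abstracting [m ^ 2] and the common sum leaves linear goals. *)
  have : 4 <= m ^ 2 by rewrite (leq_sqr 2).
  rewrite !weight_crown_labeling.
  move: (m ^ 2) (\sum_(j < m) (4 + j)) => M S.
  by case: i i' => [[|[|[|//]]] ?] [[|[|[|//]]] ?] //= M_ge4 _; lia.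
- by have := weight_leaf_lt_cycle m_ge2 bij_l q i; rewrite ltn_neqAle eq_sym => /andP[/eqP].
- by have := weight_leaf_lt_cycle m_ge2 bij_l p i'; rewrite ltn_neqAle => /andP[/eqP].
- by case: p q uv => [? ?] [? ?]; rewrite andbF.
Qed.

End Crown.

Theorem theorem3p11 (m : nat) (hm : 2 <= m) :
  chi_la_is (corona (cycle_graph 3) (null_graph m)) (3 * m + 3).
Proof.
split=> [|f /(num_colors_crown hm) -> //].
exists (@crown_labeling m); first exact: crown_labeling_local_antimagic.
exact/num_colors_crown/crown_labeling_local_antimagic.
Qed.
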